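(* Let $1\le k\le n$ and let $\alpha_{i,m}$, $k\le i\le m$, $k\le m\le n$, be given critical values (with $m$ standing for $|I|$) such that $\alpha_{i,m}$ is increasing in $i$ and decreasing in $m$ (both in the weak sense). Then: (i) The closed testing procedure with critical values $\alpha_{i,|I|}$ dominates the stepdown procedure with critical values $\alpha_i:=\alpha_{k,(n-i)+k}$, $k\le i\le n$. (ii) If, furthermore, for each given $m$ the values $\alpha_{i,m}$, $k\le i\le m$, are constant (in $i$), then these two procedures are equivalent. (iii) If for each $I\subset\{1,\dots,n\}$ with $|I|\ge k$ the local test $(I:\alpha_{i,|I|},\,k\le i\le|I|)$ is a level $\alpha$ test of $H_I$, then the stepdown procedure with critical values $\alpha_{k,(n-i)+k}$, $k\le i\le n$, controls the $k$-FWER at level $\alpha$.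
   Context: Setting: $H_1,\dots,H_n$ are null hypotheses (subsets of $\Omega$, the set of all possible distributions of the data), with $p$-values $P_1,\dots,P_n$ such that $P\{P_i\le u\}\le u$ for all $u\in(0,1)$ whenever $H_i$ is true (joint dependence arbitrary). The family satisfies the free combination condition: for any $I\subseteq\{1,\dots,n\}$ there is $P\in\Omega$ for which all $H_i$, $i\in I$, are true and all $H_i$, $i\notin I$, are false. The ordered $p$-values are $P_{(1)}\le\cdots\le P_{(n)}$ with associated hypotheses $H_{(1)},\dots,H_{(n)}$; the same ordering is used by all procedures. For $I\subset\{1,\dots,n\}$ with $|I|\ge k$, $H_I=\bigcap_{i\in I}H_i$ and $P_{1:I}\le\cdots\le P_{|I|:I}$ are the ordered values of $P_i$, $i\in I$. Local test: $(I:\alpha_{i,|I|},\,k\le i\le|I|)$ rejects $H_I$ iff $P_{j:I}\le\alpha_{j,|I|}$ for at least one $j\in\{k,\dots,|I|\}$. It is level $\alpha$ if $P\big(\bigcup_{j=k}^{|I|}\{P_{j:I}\le\alpha_{j,|I|}\}\big)\le\alpha$ whenever $H_I$ is true. Closed testing procedure with critical values $\alpha_{i,|I|}$: it automatically rejects $H_{(1)},\dots,H_{(k-1)}$, and it rejects any other $H_i$ iff $H_I$ is rejected by the local test $(I:\alpha_{j,|I|},\,k\le j\le|I|)$ for all $I\subset\{1,\dots,n\}$ with $|I|\ge k$, $i\in I$ and $P_i\ge P_{k:I}$. Stepdown procedure with critical values $\alpha_k\le\cdots\le\alpha_n$: if $P_{(k)}>\alpha_k$, reject $H_{(1)},\dots,H_{(k-1)}$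 only; otherwise reject $H_{(1)},\dots,H_{(r)}$, where $r\ge k$ is the largest index satisfying $P_{(k)}\le\alpha_k,\dots,P_{(r)}\le\alpha_r$. Comparison: two procedures are equivalent if they always reject (and accept) the same individual hypotheses. Procedure $A$ dominates procedure $B$ if $A$ always rejects at least those individual hypotheses rejected by $B$. $k$-FWER: if $V$ is the number of true null hypotheses that are rejected, $k\text{-FWER}=P\{V\ge k\}$; a procedure controls it at level $\alpha$ if $P\{V\ge k\}\le\alpha$ for every $P\in\Omega$. *)

(* Defs.v *)
From HB Require Import structures.
From mathcomp Require Import all_boot all_order all_algebra all_fingroup.
From mathcomp Require Import all_classical all_reals all_analysis.

Set Implicit Arguments.
Unset Strict Implicit.
Unset Printing Implicit Defensive.

Import Order.TTheory GRing.Theory Num.Theory.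

Local Open Scope classical_set_scope.
Local Open Scope ring_scope.

(* Hypotheses are indexed by 'I_n (from 0), whereas ranks, order statistics   *)
(* and critical values use natural numbers counted from 1.                    *)

Section RealizedPValues.
Context {R : realType} {n : nat}.
Implicit Types (P : 'I_n -> R) (I : {set 'I_n}) (s : 'S_n).

(* P_{j:I}, for 1 <= j <= |I|; P_(j) is the case of the full index set. *)
Definition ordered_pvalue P I (j : nat) : R :=
  nth 0 (sort <=%R [seq P i | i in I]) j.-1.

(* s lists the hypotheses H_(1), ..., H_(n): H_(j.+1) is H_(s j). When several *)
(* p-values coincide there are several such s.                                *)
Definition is_ordering P s : Prop :=
  forall a b : 'I_n, (a <= b)%N -> P (s a) <= P (s b).

Definition rank s (i : 'I_n) : nat := ((s^-1)%g i).+1.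

(* H_(1), ..., H_(r) *)
Definition first_ranked s (r : nat) : {set 'I_n} :=
  [set i | (rank s i <= r)%N]%SET.

Definition local_rejects (k : nat) (alpha : nat -> nat -> R) P I : bool :=
  has (fun j => ordered_pvalue P I j <= alpha j #|I|) (index_iota k #|I|.+1).

Definition closed_testing (k : nat) (alpha : nat -> nat -> R) P s :
    {set 'I_n} :=
  first_ranked s k.-1 :|:
  [set i | [forall I : {set 'I_n},
     [&& (k <= #|I|)%N, i \in I & ordered_pvalue P I k <= P i]
       ==> local_rejects k alpha P I]]%SET.

Definition stepdown (k : nat) (c : nat -> R) P s : {set 'I_n} :=
  let p j := ordered_pvalue P [set: 'I_n]%SET j in
  if c k < p k then first_ranked s k.-1
  else first_ranked s
    (\max_(k <= r < n.+1 | all (fun j => p j <= c j) (index_iota k r.+1)) r).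

End RealizedPValues.

(* A multiple testing procedure maps the data to the set of rejected indices. *)
Section Procedures.
Context {T : Type} {n : nat}.
Implicit Types A B : T -> {set 'I_n}.

Definition dominates A B : Prop := forall x, B x \subset A x.

Definition equivalent A B : Prop := forall x, A x = B x.

End Procedures.

Section Model.
Context {R : realType} {d : measure_display} {T : measurableType d} {n : nat}.
Implicit Types (Omega : set (probability T R))
  (H : 'I_n -> set (probability T R)) (p : 'I_n -> {mfun T >-> R}).

Definition true_nulls H (Q : probability T R) : {set 'I_n} :=
  [set i | `[< H i Q >]]%SET.

Definition free_combination Omega H : Prop :=
  forall I : {set 'I_n}, exists2 Q, Omega Q & forall i, H i Q <-> i \in I.

Definition valid_pvalues H p : Prop :=
  forall i Q, H i Q -> forall u : R, 0 < u < 1 ->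
    (Q [set x | (p i x <= u)%R] <= u%:E)%E.

Definition level_local_test Omega H p (k : nat) (alpha : nat -> nat -> R)
    (a : R) (I : {set 'I_n}) : Prop :=
  forall Q, Omega Q -> (forall i, i \in I -> H i Q) ->
    (Q (\bigcup_(j in [set j : nat | (k <= j <= #|I|)%N])
          [set x | (ordered_pvalue (fun i => p i x) I j <= alpha j #|I|)%R])
       <= a%:E)%E.

(* Q {V >= k}. The event has to be measurable for this to be a genuine         *)
(* probability; for the stepdown procedure with nondecreasing critical values *)
(* and measurable p-values it is, however ties are broken in the ordering.    *)
Definition kFWER H (k : nat) (A : T -> {set 'I_n}) (Q : probability T R) :
    \bar R :=
  Q [set x | (k <= #|A x :&: true_nulls H Q|)%N].

Definition controls_kFWER Omega H (k : nat) (a : R) (A : T -> {set 'I_n}) :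
    Prop :=
  forall Q, Omega Q -> (kFWER H k A Q <= a%:E)%E.

End Model.

(* Main.v *)
Require Import Defs.
From HB Require Import structures.
From mathcomp Require Import all_boot all_order all_algebra all_fingroup.
From mathcomp Require Import all_classical all_reals all_analysis.
From mathcomp Require Import zify.

(** Write P_(r) for the r-th smallest p-value, c_r = alpha_{k,n-r+k} for the
    stepdown critical values and m = |I|. Everything rests on two facts.

    Pigeonhole ([ordered_pvalue_sub]): only n - m hypotheses lie outside I, so
    k of the n-m+k smallest p-values belong to I, that is,
    P_{k:I} <= P_(n-m+k).

    Crossing ([ordered_pvalue_le_crit]): suppose that P_(j) <= c_j for
    k <= j <= r and that P_{k:I} <= P_(r); then P_{k:I} <= alpha_{k,m}, so the
    local test rejects H_I. Note that t = n-m+k satisfies c_t = alpha_{k,m}. If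
    t <= r, the pigeonhole gives P_{k:I} <= P_(t) <= c_t. If r < t, then
    P_{k:I} <= P_(r) <= c_r <= c_t, as the c_j increase with j.

    The stepdown procedure rejects the hypothesis of rank q exactly when
    P_(j) <= c_j for all k <= j <= q ([mem_stepdown]), so (i) is the crossing
    fact with r = q: closed testing looks only at the I that contain this
    hypothesis and satisfy P_{k:I} <= P_(q).

    For (ii), let k <= t <= q with P_(t) > c_t, and let I consist of the
    hypotheses of ranks t-k+1, ..., n. Then |I| = n-t+k and
    P_{k:I} = P_(t) > c_t. When the critical values for a given size are
    constant, c_t is the critical value of every rank of I, so that H_I is
    accepted and the hypothesis of rank q is not rejected by closed testing.

    For (iii), take for I the set of true nulls. If at least k of them are
    rejected, let r be the largest rank among these; then P_{k:I} <= P_(r), and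
    by the crossing fact the local test rejects H_I, an event of probability at
    most a. If |I| < k, the error event is empty, and a >= 0 because some
    distribution makes all the hypotheses true.

    The ordering that breaks ties is an arbitrary function of the data, yet
    comparing probabilities requires the error event to be measurable.
    [card_stepdownP] describes this event through order statistics alone, which
    are measurable. *)

Set Implicit Arguments.
Unset Strict Implicit.
Unset Printing Implicit Defensive.

Import Order.TTheory GRing.Theory Num.Theory.

Local Open Scope classical_set_scope.
Local Open Scope ring_scope.

(** * Order statistics and ranks *)

Section OrderedPValues.
Context {R : realType} {n : nat}.
Implicit Types (P : 'I_n -> R) (I : {set 'I_n}) (s : 'S_n).

Lemma card_le_n I : (#|I| <= n)%N.
Proof. by rewrite -[X in (_ <= X)%N]card_ord max_card. Qed.

(** Turns statements about sorted lists into statements about cardinals, the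
    form in which order statistics of different index sets can be compared. *)
Lemma ordered_pvalue_le P I j c : (0 < j <= #|I|)%N ->
  (ordered_pvalue P I j <= c) = (j <= #|[set i in I | (P i <= c)%R]|)%N.
Proof.
move=> /andP[j0 jI]; rewrite /ordered_pvalue.
set u := [seq P i | i in I]; set v := sort _ _.
have v_sorted : sorted <=%O v by apply: sort_sorted; exact: le_total.
have v_size : size v = #|I| by rewrite size_sort size_image.
have -> : #|[set i in I | (P i <= c)%R]| = count (<= c)%O v.
  rewrite (seq.permP (permEl (perm_sort _ _))) count_map cardE -size_filter.
  rewrite /enum_mem -filter_predI; congr size; apply: eq_filter => i /=.
  by rewrite !inE andbC.
apply/idP/idP => [le_c|le_j]; last by apply: nth_count_le => //; rewrite prednK.
rewrite leqNgt; apply/negP => lt_j.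
have := @nth_count_gt _ _ c 0 v j.-1 v_sorted.
by rewrite v_size -ltnS prednK // lt_j jI ltNge le_c => /(_ isT).
Qed.

Lemma ordered_pvalue_mono P I i j : (0 < i)%N -> (i <= j <= #|I|)%N ->
  ordered_pvalue P I i <= ordered_pvalue P I j.
Proof.
move=> i0 /andP[ij jI]; rewrite ordered_pvalue_le; last by lia.
by apply: (leq_trans ij); rewrite -ordered_pvalue_le ?lexx ?jI ?andbT; lia.
Qed.

Lemma rank_bounds s i : (0 < rank s i <= n)%N.
Proof. by rewrite /rank /=. Qed.

Lemma card_first_ranked s r : (r <= n)%N -> #|first_ranked s r| = r.
Proof.
move=> rn; have -> : first_ranked s r = s @: [set a : 'I_n | (a < r)%N]%SET.
  apply/setP => i; rewrite -(permKV s i) mem_imset; last exact: perm_inj.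
  by rewrite !inE /rank permK.
rewrite card_imset; last exact: perm_inj.
have -> : [set a : 'I_n | (a < r)%N]%SET = widen_ord rn @: [set: 'I_r]%SET.
  apply/setP => a; rewrite inE; apply/idP/imsetP => [ar|[b _ ->]].
    by exists (Ordinal ar) => //; apply/val_inj.
  by rewrite /= ltn_ord.
rewrite card_imset ?cardsT ?card_ord // => a b /(congr1 val) /= ab.
exact/val_inj.
Qed.

Section Ordering.
Variables (P : 'I_n -> R) (s : 'S_n).
Hypothesis s_ord : is_ordering P s.
Local Notation p := (ordered_pvalue P [set: 'I_n]%SET).

Lemma rank_le i j : (rank s i <= rank s j)%N -> P i <= P j.
Proof. by rewrite /rank ltnS => /s_ord; rewrite !permKV. Qed.

Lemma ordered_pvalue_rank i : p (rank s i) = P i.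
Proof.
have [r0 rn] := andP (rank_bounds s i).
have r_card : (0 < rank s i <= #|[set: 'I_n]%SET|)%N.
  by rewrite cardsT card_ord r0.
apply/eqP; rewrite eq_le ordered_pvalue_le //; apply/andP; split.
  rewrite -[X in (X <= _)%N](card_first_ranked s rn).
  by apply/subset_leq_card/fintype.subsetP => j; rewrite !inE => /rank_le.
rewrite leNgt; apply/negP => lt_i.
have := lexx (p (rank s i)); rewrite {1}ordered_pvalue_le //.
apply/negP; rewrite -ltnNge -(prednK r0) ltnS.
(* A p-value below that of i has a strictly smaller rank. *)
rewrite -[X in (_ <= X)%N](@card_first_ranked s); last by lia.
apply/subset_leq_card/fintype.subsetP => j; rewrite !inE => le_j.
rewrite -ltnS prednK // ltnNge; apply/negP => /rank_le le_ij.
by have := lt_le_trans lt_i (le_trans le_ij le_j); rewrite ltxx.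
Qed.

End Ordering.

(** Among the n - |I| + k smallest p-values, at most n - |I| have their index
    outside I. *)
Lemma ordered_pvalue_sub P I k : (0 < k <= #|I|)%N ->
  ordered_pvalue P I k <= ordered_pvalue P [set: 'I_n]%SET (n - #|I| + k).
Proof.
move=> kI; rewrite ordered_pvalue_le //.
have In := card_le_n I.
set t := (n - #|I| + k)%N; set v := ordered_pvalue P _ t.
have tn : (0 < t <= #|[set: 'I_n]%SET|)%N by rewrite cardsT card_ord; lia.
have := lexx v; rewrite {1}/v (ordered_pvalue_le P v tn) -(cardsID I).
set A := (_ :&: I)%SET; set B := (_ :\: I)%SET => t_le.
have AE : A = [set i in I | (P i <= v)%R]%SET.
  by apply/setP => i; rewrite !inE andbC.
have BI : (#|B| <= n - #|I|)%N.
  have := cardsC I; rewrite card_ord => IC.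
  have : (#|B| <= #|~: I|)%N; last by lia.
  by apply/subset_leq_card/fintype.subsetP => i; rewrite !inE => /andP[].
rewrite -AE; lia.
Qed.

(** * The rejections of the stepdown procedure *)

(** Ranks below k are covered too, since the range of j is then empty: the
    automatic rejections and the stepwise ones share this description. *)
Lemma mem_stepdown (c : nat -> R) P s k i : (0 < k <= n)%N ->
  (i \in stepdown k c P s) =
  all (fun j => ordered_pvalue P [set: 'I_n]%SET j <= c j)
    (index_iota k (rank s i).+1).
Proof.
move=> kn; rewrite /stepdown; set p := ordered_pvalue P _.
have [r0 rn] := andP (rank_bounds s i).
case: ltP => [gt_k|le_k].
  rewrite inE; apply/idP/allP => [rk j|]; first by rewrite mem_index_iota; lia.
  move=> good; rewrite leqNgt; apply/negP => rk; have := good k.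
  by rewrite mem_index_iota => /(_ ltac:(lia)); rewrite leNgt gt_k.
rewrite inE; apply/idP/allP => [rmax j|good].
  rewrite mem_index_iota => /andP[kj jr].
  apply/negP => /negP bad; move: rmax; apply/negP; rewrite -ltnNge.
  (* No r >= j is admissible, so the maximum is below j. *)
  apply: (@leq_ltn_trans j.-1); last by lia.
  apply/bigmax_leqP_seq => r; rewrite mem_index_iota => kr /allP good_r.
  rewrite -ltnS prednK; last by lia.
  rewrite ltnNge; apply: contra bad => jr'; apply: good_r.
  by rewrite mem_index_iota; lia.
have [rk|kr] := ltnP (rank s i) k.
  apply: (leq_trans (ltnW rk)).
  apply: (@leq_bigmax_seq _ _ _ id).
    by rewrite mem_index_iota; lia.
  by apply/allP => j; rewrite mem_index_iota => jk; have -> : j = k by lia.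
apply: (@leq_bigmax_seq _ _ _ id); first by rewrite mem_index_iota; lia.
exact/allP.
Qed.

(** For the direct implication, r is the largest rank of a rejected element of I.
    For the converse, each i in I with P i <= P_(r) is rejected: if its rank
    exceeds r, this is because of ties, which the monotonicity of c absorbs. The
    right-hand side depends on the p-values only, not on the ordering s. *)
Lemma card_stepdownP (c : nat -> R) P s k I : (0 < k <= #|I|)%N ->
    is_ordering P s ->
    (forall i j, (k <= i <= j)%N -> (j <= n)%N -> c i <= c j) ->
  (k <= #|stepdown k c P s :&: I|)%N <->
  exists2 r, (k <= r <= n)%N &
    ordered_pvalue P I k <= ordered_pvalue P [set: 'I_n]%SET r /\
    (forall j, (k <= j <= r)%N -> ordered_pvalue P [set: 'I_n]%SET j <= c j).
Proof.
move=> kI s_ord c_incr.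
have In := card_le_n I.
have kn : (0 < k <= n)%N by lia.
split=> [kV|[r kr [Ir good]]].
  have /card_gt0P[i0 i0V] : (0 < #|stepdown k c P s :&: I|)%N by lia.
  have [i iV i_max] : exists2 i, i \in stepdown k c P s :&: I &
      forall j, j \in stepdown k c P s :&: I -> (rank s j <= rank s i)%N.
    by case: (arg_maxnP (rank s) i0V) => i iV i_max; exists i.
  have i_le j : j \in stepdown k c P s :&: I -> P j <= P i.
    by move=> /i_max; exact: rank_le.
  move: iV; rewrite inE mem_stepdown // => /andP[/allP good _].
  have [_ rn] := andP (rank_bounds s i).
  exists (rank s i).
    rewrite rn andbT -[X in (_ <= X)%N](card_first_ranked s rn).
    apply: leq_trans kV (subset_leq_card _).
    by apply/fintype.subsetP => j /i_max; rewrite inE.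
  split=> [|j kj]; last by apply: good; rewrite mem_index_iota; lia.
  rewrite (ordered_pvalue_rank s_ord) ordered_pvalue_le //.
  apply: leq_trans kV (subset_leq_card _); apply/fintype.subsetP => j jV.
  by move: (jV); rewrite inE => /andP[_ jI]; rewrite inE jI i_le.
move: Ir; rewrite ordered_pvalue_le // => /leq_trans; apply.
apply/subset_leq_card/fintype.subsetP => i; rewrite !inE => /andP[-> le_i].
rewrite andbT mem_stepdown //; apply/allP => j; rewrite mem_index_iota ltnS.
move=> /andP[kj ji].
(* If r < j <= rank s i, then P_(j) <= P i <= P_(r) <= c r <= c j. *)
have [jr|rj] := leqP j r; first by apply: good; rewrite kj.
have [_ rn] := andP (rank_bounds s i).
apply: le_trans (ordered_pvalue_mono P _ _) _.
- by lia.
- by rewrite cardsT card_ord; apply/andP; split; [exact: ji|].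
rewrite (ordered_pvalue_rank s_ord); apply: le_trans le_i _.
apply: le_trans (good r _) _; first by lia.
by apply: c_incr; lia.
Qed.

(** * Comparison with closed testing *)

Section Comparison.
Variables (k : nat) (alpha : nat -> nat -> R).
Hypothesis kn : (0 < k <= n)%N.
Local Notation crit := (fun i => alpha k (n - i + k)%N).

Section Decreasing.
Hypothesis alpha_decr : forall m m',
  (k <= m <= m')%N -> (m' <= n)%N -> alpha k m' <= alpha k m.

Lemma crit_incr i j : (k <= i <= j)%N -> (j <= n)%N -> crit i <= crit j.
Proof. by move=> ij jn; apply: alpha_decr; lia. Qed.

(** The index t = n - |I| + k satisfies [crit t = alpha k #|I|]. Either the
    condition at t is one of those assumed, and P_{k:I} <= P_(t), or r < t and
    [crit r <= crit t]. *)
Lemma ordered_pvalue_le_crit P I r : (k <= #|I|)%N -> (k <= r <= n)%N ->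
    (forall j, (k <= j <= r)%N ->
       ordered_pvalue P [set: 'I_n]%SET j <= crit j) ->
    ordered_pvalue P I k <= ordered_pvalue P [set: 'I_n]%SET r ->
  ordered_pvalue P I k <= alpha k #|I|.
Proof.
move=> kI kr good Ir; have In := card_le_n I.
have [tr|rt] := leqP (n - #|I| + k) r.
  apply: le_trans (ordered_pvalue_sub P _) _; first by lia.
  have /good := (ltac:(lia) : (k <= n - #|I| + k <= r)%N).
  by have -> : (n - (n - #|I| + k) + k = #|I|)%N by lia.
apply: le_trans Ir (le_trans (good r ltac:(lia)) _).
by apply: alpha_decr; lia.
Qed.

Lemma stepdown_sub_closed_testing P s : is_ordering P s ->
  stepdown k crit P s \subset closed_testing k alpha P s.
Proof.
move=> s_ord; apply/fintype.subsetP => i.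
rewrite mem_stepdown // => /allP good.
rewrite finset.in_setU; have [rk|kr] := ltnP (rank s i) k.
  by rewrite inE; apply/orP; left; lia.
apply/orP; right; rewrite inE; apply/forallP => I.
apply/implyP => /and3P[kI iI le_i].
have [_ rn] := andP (rank_bounds s i).
apply/hasP; exists k; first by rewrite mem_index_iota; lia.
apply: (@ordered_pvalue_le_crit _ _ (rank s i)) => //.
- by lia.
- by move=> j kj; apply: good; rewrite mem_index_iota; lia.
- by rewrite (ordered_pvalue_rank s_ord).
Qed.

Lemma stepdown_local_test P s I : (k <= #|I|)%N -> is_ordering P s ->
    (k <= #|stepdown k crit P s :&: I|)%N ->
  ordered_pvalue P I k <= alpha k #|I|.
Proof.
move=> kI s_ord; have kI' : (0 < k <= #|I|)%N by lia.
move=> /(card_stepdownP kI' s_ord crit_incr)[r kr [Ir good]].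
exact: ordered_pvalue_le_crit Ir.
Qed.

End Decreasing.

(** If the stepdown procedure stops at rank t, the k-th smallest p-value of the
    set I of ranks t-k+1, ..., n is P_(t), above every critical value of I. *)
Lemma closed_testing_sub_stepdown P s : is_ordering P s ->
    (forall i m, (k <= i <= m)%N -> (m <= n)%N -> alpha i m = alpha k m) ->
  closed_testing k alpha P s \subset stepdown k crit P s.
Proof.
move=> s_ord alpha_cst; apply/fintype.subsetP => i.
rewrite finset.in_setU => iC; rewrite mem_stepdown //; apply/allP => t.
rewrite mem_index_iota => /andP[kt tr]; apply/negP => /negP; rewrite -ltNge.
move=> bad; move: iC; apply/negP; rewrite negb_or; apply/andP; split.
  by rewrite inE -ltnNge; lia.
have [_ rn] := andP (rank_bounds s i).
set I := (~: first_ranked s (t - k))%SET.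
have cardI : #|I| = (n - t + k)%N.
  have := cardsC (first_ranked s (t - k)).
  by rewrite card_first_ranked ?card_ord -/I; lia.
rewrite inE negb_forall; apply/existsP; exists I; rewrite negb_imply.
apply/andP; split.
  apply/and3P; split; first by rewrite cardI; lia.
    by rewrite !inE -ltnNge; lia.
  apply: le_trans (ordered_pvalue_sub _ _) _; first by rewrite cardI; lia.
  rewrite -[leRHS](ordered_pvalue_rank s_ord); apply: ordered_pvalue_mono.
    by lia.
  by rewrite cardI cardsT card_ord; lia.
apply/hasPn => j; rewrite mem_index_iota => kj.
rewrite alpha_cst ?cardI //; try by lia.
rewrite ordered_pvalue_le; last by lia.
rewrite -ltnNge; apply: (@leq_ltn_trans k.-1); last by lia.
(* An element of I whose p-value is at most crit t ranks between t-k+1 and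
   t-1. *)
have -> : k.-1 = #|first_ranked s t.-1 :\: first_ranked s (t - k)|.
  rewrite cardsD (finset.setIidPr _) ?card_first_ranked; try by lia.
  by apply/fintype.subsetP => b; rewrite !inE; lia.
apply/subset_leq_card/fintype.subsetP => b; rewrite !inE => /andP[-> /= le_b].
rewrite -ltnS prednK; last by lia.
rewrite ltnNge; apply/negP => tb.
have [_ bn] := andP (rank_bounds s b).
have := lt_le_trans bad (ordered_pvalue_mono P _ _).
move=> /(_ (rank s b)); rewrite cardsT card_ord.
move=> /(_ ltac:(lia) ltac:(lia)).
by rewrite (ordered_pvalue_rank s_ord) ltNge le_b.
Qed.

End Comparison.

End OrderedPValues.

(** * Measurability of the error event *)

Section Measurability.
Context {R : realType} {d : measure_display} {T : measurableType d}.

(** A random finite set takes finitely many values, and each event that it has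
    a given value is a finite intersection of measurable events. *)
Lemma measurable_finset_pred (A : finType) (b : A -> T -> bool)
    (F : pred {set A}) :
  (forall i, measurable [set x | b i x]) ->
  measurable [set x | F [set i | b i x]%SET].
Proof.
move=> mb.
have -> : [set x | F [set i | b i x]%SET] =
    \bigcup_(J in [set J : {set A} | F J])
      \bigcap_(i in [set: A]) [set x | b i x = (i \in J)].
  apply/seteqP; split=> x /= => [Fx|[J /= FJ bJ]].
    by exists [set i | b i x]%SET => // i _ /=; rewrite inE.
  by have -> : [set i | b i x]%SET = J by apply/setP => i; rewrite inE bJ.
apply: fin_bigcup_measurable => [|J _]; first exact: finite_finset.
apply: fin_bigcap_measurable => [|i _]; first exact: finite_finset.
case: (i \in J); first exact: mb.
rewrite (_ : mkset _ = ~` [set x | b i x]); first exact: measurableC.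
by apply/seteqP; split=> x /=; case: (b i x).
Qed.

Context {n : nat} (p : 'I_n -> {mfun T >-> R}).
Implicit Types I : {set 'I_n}.

Lemma measurable_ordered_pvalue I j : (0 < j <= #|I|)%N ->
  measurable_fun setT (fun x => ordered_pvalue (fun i => p i x) I j).
Proof.
move=> jI mT; apply: (measurability _ (measurable_realfun.RGenOInfty.measurableE R)) => //.
move=> _ [_ [c ->] <-]; rewrite setTI.
have -> : (fun x => ordered_pvalue (fun i => p i x) I j) @^-1` `]c, +oo[ =
    ~` [set x | (j <= #|I :&: [set i | (p i x <= c)%R]%SET|)%N].
  apply/seteqP; split=> x /=; rewrite in_itv /= andbT ltNge ordered_pvalue_le //;
    by rewrite setIdE => /negP.
apply: measurableC.
apply: (@measurable_finset_pred _ (fun i x => p i x <= c)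
  (fun J => (j <= #|I :&: J|)%N)) => i.
rewrite -[mkset _]setTI; exact: measurable_fun_le.
Qed.

Lemma measurable_ordered_pvalue_le I j (c : R) : (0 < j <= #|I|)%N ->
  measurable [set x | ordered_pvalue (fun i => p i x) I j <= c].
Proof.
move=> jI; rewrite -[mkset _]setTI; apply: measurable_fun_le => //.
exact: measurable_ordered_pvalue.
Qed.

(** The ordering s need not depend measurably on the data; the event is expressed
    by order statistics, whatever the choice of s. *)
Lemma measurable_card_stepdown (c : nat -> R) (s : T -> 'S_n) k I :
    (0 < k <= #|I|)%N -> (forall x, is_ordering (fun i => p i x) (s x)) ->
    (forall i j, (k <= i <= j)%N -> (j <= n)%N -> c i <= c j) ->
  measurable [set x | (k <= #|stepdown k c (fun i => p i x) (s x) :&: I|)%N].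
Proof.
move=> kI s_ord c_incr.
have -> : [set x | (k <= #|stepdown k c (fun i => p i x) (s x) :&: I|)%N] =
    \bigcup_(r in [set r | (k <= r <= n)%N])
      ([set x | ordered_pvalue (fun i => p i x) I k <=
                ordered_pvalue (fun i => p i x) [set: 'I_n]%SET r] `&`
       \bigcap_(j in [set j | (k <= j <= r)%N])
         [set x | ordered_pvalue (fun i => p i x) [set: 'I_n]%SET j <= c j]).
  apply/seteqP; split=> x /=.
    by move=> /(card_stepdownP kI (s_ord x) c_incr)[r kr [? ?]]; exists r.
  move=> [r kr [? ?]]; apply/(card_stepdownP kI (s_ord x) c_incr).
  by exists r.
apply: bigcup_measurable => r /= kr; apply: measurableI.
  rewrite -[mkset _]setTI; apply: measurable_fun_le => //;
    apply: measurable_ordered_pvalue => //.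
  by rewrite cardsT card_ord; lia.
apply: bigcap_measurable => [|j /= kj]; first by exists k => /=; lia.
by apply: measurable_ordered_pvalue_le; rewrite cardsT card_ord; lia.
Qed.

End Measurability.

(** * The comparison theorem and control of the k-FWER *)

Theorem theorem4p1 (R : realType) (d : measure_display) (T : measurableType d)
  (n k : nat)
  (Omega : set (probability T R)) (H : 'I_n -> set (probability T R))
  (p : 'I_n -> {mfun T >-> R}) (s : T -> 'S_n)
  (alpha : nat -> nat -> R)
  (hk : (1 <= k <= n)%N)
  (hH : forall i, H i `<=` Omega)
  (hfree : free_combination Omega H)
  (hp : valid_pvalues H p)
  (hs : forall x, is_ordering (fun i => p i x) (s x))
  (alpha_incr : forall i j m, (k <= i)%N -> (i <= j)%N -> (j <= m)%N ->
     (m <= n)%N -> alpha i m <= alpha j m)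
  (alpha_decr : forall i m m', (k <= i)%N -> (i <= m)%N -> (m <= m')%N ->
     (m' <= n)%N -> alpha i m' <= alpha i m) :
  let closed_proc x := closed_testing k alpha (fun i => p i x) (s x) in
  let stepdown_proc x :=
    stepdown k (fun i => alpha k (n - i + k)%N) (fun i => p i x) (s x) in
  [/\ dominates closed_proc stepdown_proc,
      (forall i j m, (k <= i <= m)%N -> (k <= j <= m)%N -> (m <= n)%N ->
         alpha i m = alpha j m) ->
      equivalent closed_proc stepdown_proc
    & forall a : R,
      (forall I : {set 'I_n}, (k <= #|I|)%N ->
         level_local_test Omega H p k alpha a I) ->
      controls_kFWER Omega H k a stepdown_proc].
Proof.
move=> closed_proc stepdown_proc.
have decr_k m m' : (k <= m <= m')%N -> (m' <= n)%N -> alpha k m' <= alpha k m.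
  by move=> /andP[km mm'] m'n; exact: alpha_decr.
have dom : dominates closed_proc stepdown_proc.
  by move=> x; exact: stepdown_sub_closed_testing.
split=> // [alpha_cst x|a test_a Q OQ].
  apply/eqP; rewrite finset.eqEsubset dom andbT.
  apply: closed_testing_sub_stepdown => // i m im mn.
  by apply: alpha_cst => //; lia.
rewrite /kFWER; have [kI|Ik] := leqP k #|true_nulls H Q|; last first.
  have -> : [set x | (k <= #|stepdown_proc x :&: true_nulls H Q|)%N] = set0.
    apply/seteqP; split=> x //= kV.
    have := leq_trans kV (subset_leq_card (finset.subsetIr _ _)).
    by rewrite leqNgt Ik.
  (* The level a is nonnegative: it bounds a probability. *)
  have [Q' OQ' HQ'] := hfree [set: 'I_n]%SET.
  rewrite measure0; apply: le_trans (test_a [set: 'I_n]%SET _ Q' OQ' _).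
  - exact: measure_ge0.
  - by rewrite cardsT card_ord; lia.
  - by move=> i /HQ'.
have trueI i : i \in true_nulls H Q -> H i Q by rewrite inE => /asboolP.
apply: le_trans (test_a _ kI Q OQ trueI).
move: (true_nulls H Q) kI {trueI} => I kI.
apply: le_measure; rewrite ?inE.
- apply: measurable_card_stepdown => //; first by lia.
  exact: crit_incr.
- apply: bigcup_measurable => j /= /andP[kj jI].
  by apply: measurable_ordered_pvalue_le; rewrite jI andbT; lia.
- move=> x /= kV; exists k => /=; first by rewrite leqnn.
  exact: stepdown_local_test kV.
Qed.
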